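(* Let $k,r\ge 1$ be integers, $p\in(0,1)$, $q=1-p$. Let $Y$ be the waiting time for the $r$-th nonoverlapping success run of length $k$ (negative binomial distribution $\mathrm{NB}_{k,r}$ of Type I). Then for every integer $n\ge 1$ the factorial moment $\hat M_{(n)}=\mathbb{E}[Y(Y-1)\cdots(Y-n+1)]$ is $$\hat M_{(n)}=n!\,p^{rk}\sum_{v=\max(0,\,n-rk)}^{\infty}\binom{v+rk}{n}\sum_{j=0}^{v}(-1)^{v-j}p^{v-j}\binom{r}{v-j}\sum_{i=0}^{\lfloor j/(k+1)\rfloor}(-1)^iq^ip^{ik}\binom{r+i-1}{r-1}\binom{r+j-ik-1}{r+i-1}.$$
   Context: Consider independent Bernoulli trials, indexed $1,2,3,\dots$, each with success probability $p$. Success runs of length $k$ are counted in the nonoverlapping sense: as soon as $k$ consecutive successes are attained, a run is counted and the counting for a new run begins from scratch with the next trial. $Y$ is the index of the trial at which the $r$-th such run is completed; equivalently, $Y$ is the sum of $r$ independent copies of the waiting time for the first run of $k$ consecutive successes. Its probability generating function is $\left(\frac{p^ks^k(1-ps)}{1-s+qp^ks^{k+1}}\right)^r$. Convention: $\binom{a}{b}=0$ unless $0\le b\le a$. *)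

(* Defs.v *)
From HB Require Import structures.
From mathcomp Require Import all_boot all_order all_algebra finmap.
From mathcomp Require Import all_classical all_reals all_analysis.

Set Implicit Arguments.
Unset Strict Implicit.
Unset Printing Implicit Defensive.

Import Order.TTheory GRing.Theory Num.Theory.
Import numFieldNormedType.Exports.

Local Open Scope classical_set_scope.
Local Open Scope ring_scope.

Definition mutually_independent d d' (T : measurableType d)
    (T' : measurableType d') (R : realType) (P : probability T R)
    (I : choiceType) (X : I -> T -> T') : Prop :=
  forall (J : {fset I}) (B : I -> set T'),
    (forall i, measurable (B i)) ->
    P (\bigcap_(i in [set` J]) (X i @^-1` B i)) =
    (\prod_(i <- J) P (X i @^-1` B i))%E.

(* For an infinite record x of trials, [x i] is the outcome of trial number
   i + 1 (true = success).  [run_state k x m] is the pair (number of success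
   runs of length k completed during the first m trials, length of the current
   unfinished streak of successes); the streak restarts from 0 each time a run
   is counted, so that runs do not overlap. *)
Fixpoint run_state (k : nat) (x : nat -> bool) (m : nat) : nat * nat :=
  if m is m'.+1 then
    let: (c, s) := run_state k x m' in
    if x m' then (if s.+1 == k then (c.+1, 0%N) else (c, s.+1))
    else (c, 0%N)
  else (0%N, 0%N).

Definition run_count (k : nat) (x : nat -> bool) (m : nat) : nat :=
  (run_state k x m).1.

(* Index (counted from 1) of the trial completing the r-th run; it is +oo on
   the records that contain fewer than r runs. *)
Definition waiting_time (R : realType) (k r : nat) (x : nat -> bool) : \bar R :=
  ereal_inf [set m%:R%:E | m in [set m : nat | (r <= run_count k x m)%N]].

(* Main.v *)
Require Import Defs.
From HB Require Import structures.
From mathcomp Require Import all_boot all_order all_algebra finmap.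
From mathcomp Require Import all_classical all_reals all_analysis.
From mathcomp Require Import measurable_realfun ring lra zify.

Set Implicit Arguments.
Unset Strict Implicit.
Unset Printing Implicit Defensive.

Import Order.TTheory GRing.Theory Num.Theory.
Import numFieldNormedType.Exports.

Local Open Scope classical_set_scope.
Local Open Scope ring_scope.

(** Let [f r N] be the probability that the [r]-th run is completed exactly at
trial [N], and let [S] be the operator that delays a sequence by one step.

The law.  The [r.+1]-st run is completed at trial [N + k] exactly when the
counting starts from scratch after trial [N] with [r] runs counted, and the
next [k] trials succeed.  A fresh start with [r] runs comes either from the
completion of the [r]-th run at trial [N], or from a failure at trial [N] while
[r] runs are counted.  Eliminating the law of the run count from these two
relations gives [wait_pmf_recurrence]:
  (1 - S + q p^k S^(k+1)) f_(r+1) = p^k S^k (1 - p S) f_r.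
The operator on the left is injective, so this recurrence has one solution.
The double sum of the formula is the [r]-th power of (1 - p S) applied to
a sequence [runcoef r], the coefficients of (1 - X + q p^k X^(k+1))^(-r);
Pascal's rule shows that the operator on the left lowers [r] by one on these
([runop_runcoef]).  Since the operators commute, [p ^+ (r * k)] times the
double sum, delayed by [r * k], solves the same recurrence
([nb_recurrence_sol], [wait_pmfE]).

The moments.  Pointwise, and also where [Y] is infinite,
  Y (Y - 1) ... (Y - n) = (n+1)! * sum over N < Y of 'C(N, n),
so the moment is (n+1)! times the sum of 'C(N, n) P(Y > N), by monotone
convergence alone ([expectation_ffact_waiting_time]).  Any [r * k] successive
successes complete [r] runs, so the tail P(Y > N) shrinks at least by the
factor 1 - p^(r k) every [r * k] trials ([wait_tail_geometric]).  Hence all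
these series converge, and summation by parts turns the sum of
'C(N, n) P(Y > N) into the sum of 'C(N, n+1) f(N) ([cvg_sum_bin_by_parts]). *)

(** * Delay operators on sequences *)

Section Delay.
Variable R : comNzRingType.
Local Notation seqR := (nat -> R^o).
Implicit Types (f g : seqR) (a p x : R).

Definition delta : seqR := fun n => (n == 0%N)%:R.

Definition delay f : seqR := fun n => if n is m.+1 then f m else 0.

Lemma delayD f g : delay (f + g) = delay f + delay g.
Proof. by apply/funext => -[|n]; rewrite !fctE /= ?addr0. Qed.

Lemma delayN f : delay (- f) = - delay f.
Proof. by apply/funext => -[|n]; rewrite !fctE /= ?oppr0. Qed.

Lemma delayZ a f : delay (a *: f) = a *: delay f.
Proof. by apply/funext => -[|n]; rewrite !fctE /= ?scaler0. Qed.

Lemma iter_delayD m f g :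
  iter m delay (f + g) = iter m delay f + iter m delay g.
Proof. by elim: m => //= m ->; rewrite delayD. Qed.

Lemma iter_delayN m f : iter m delay (- f) = - iter m delay f.
Proof. by elim: m => //= m ->; rewrite delayN. Qed.

Lemma iter_delayZ m a f : iter m delay (a *: f) = a *: iter m delay f.
Proof. by elim: m => //= m ->; rewrite delayZ. Qed.

Definition iter_delay_lin := (iter_delayD, iter_delayN, iter_delayZ).

Lemma delay_iterC m f : delay (iter m delay f) = iter m delay (delay f).
Proof. by rewrite -iterS iterSr. Qed.

Lemma iter_delayE m f n :
  iter m delay f n = if (m <= n)%N then f (n - m)%N else 0.
Proof. by elim: m n => [|m IH] [|n] //=; rewrite ?subn0 ?IH. Qed.

(** Multiplication of the generating function by 1 - p X. *)
Definition damp p f : seqR := f - p *: delay f.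

(** Multiplication of the generating function of [f] by 1 - X + x X^(k+1), the
denominator of the generating function of the waiting time when
[x = q * p ^+ k]. *)
Definition runop k x f : seqR := f - delay f + x *: iter k.+1 delay f.

Lemma runop_damp k x p f : runop k x (damp p f) = damp p (runop k x f).
Proof.
rewrite /runop /damp !(delayD, delayN, delayZ, iter_delay_lin) -delay_iterC.
rewrite !(scalerBr, scalerDr, scalerN) !scalerA [x * p]mulrC.
by apply/funext => n; rewrite !fctE; ring.
Qed.

Lemma runop_iter_delay k x m f :
  runop k x (iter m delay f) = iter m delay (runop k x f).
Proof. by rewrite /runop !iter_delay_lin delay_iterC -!iterD addnC. Qed.

Lemma runopZ k x a f : runop k x (a *: f) = a *: runop k x f.
Proof.
rewrite /runop delayZ iter_delayZ scalerDr scalerBr !scalerA.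
by rewrite [a * x]mulrC.
Qed.

(** The value of [runop k x f] at [n] is [f n] plus a combination of earlier
values of [f], so [f] is recovered by strong induction. *)
Lemma runop_inj k x : injective (runop k x).
Proof.
move=> f g fg; apply/funext; elim/ltn_ind => n IH.
have := congr1 (fun h : seqR => h n) fg.
rewrite /runop !fctE !iter_delayE.
have -> : delay f n = delay g n by case: n IH => //= n; apply.
have -> : (if (k < n)%N then f (n - k.+1)%N else 0) =
          (if (k < n)%N then g (n - k.+1)%N else 0).
  by case: ifP => // kn; apply: IH; rewrite ltn_subrL /= (leq_trans _ kn).
by move=> /addIr /addIr.
Qed.

(** * Coefficients of the generating function *)

Lemma iter_dampE p r f n : iter r (damp p) f n =
  \sum_(0 <= j < n.+1)
    (-1) ^+ (n - j) * p ^+ (n - j) * 'C(r, n - j)%:R * f j.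
Proof.
have rev (g : nat -> nat -> R) : \sum_(0 <= j < n.+1) g (n - j)%N j =
             \sum_(0 <= l < n.+1) g l (n - l)%N :> R.
  rewrite big_nat_rev /= !big_nat; apply: eq_bigr => j /andP[_ jn].
  by rewrite add0n subSS subKn.
rewrite (rev (fun l j => (-1) ^+ l * p ^+ l * 'C(r, l)%:R * f j)) {rev}.
elim: r n => [|r IH] n /=.
  rewrite big_ltn // big1_seq ?addr0 ?subn0 ?bin0 ?expr0 ?mulr1 ?mul1r //.
  move=> [|i]; rewrite mem_index_iota //= => _; by rewrite bin0n mulr0 mul0r.
rewrite {1}/damp !fctE IH; case: n => [|n] /=.
  by rewrite !big_nat1 !bin0 scaler0 subr0.
rewrite [RHS]big_nat_recl // IH [in LHS]big_nat_recl // !bin0 -addrA.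
congr (_ + _).
rewrite -[X in _ - X]/(p * _) mulr_sumr -sumrB !big_nat; apply: eq_bigr => i _.
by rewrite subSS binS natrD !exprS; ring.
Qed.

(** The coefficients of (1 - X + x X^(k+1))^(-r), obtained by expanding in
powers of x X^(k+1) / (1 - X).  The case [r = 0] is separate because the
binomial coefficients would need the lower index -1. *)
Definition runcoef k x r : seqR := fun j =>
  if r is r'.+1 then
    \sum_(0 <= i < (j %/ k.+1).+1)
      (- x) ^+ i * 'C(r' + i, r')%:R * 'C(r' + j - i * k, r' + i)%:R
  else delta j.

(** The terms beyond the cutoff vanish; a common range makes the sums for
different [j] comparable term by term. *)
Lemma runcoef_widen k x r j M : (j <= M)%N ->
  runcoef k x r.+1 j = \sum_(0 <= i < M.+1)
    (- x) ^+ i * 'C(r + i, r)%:R * 'C(r + j - i * k, r + i)%:R.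
Proof.
move=> jM; rewrite [RHS](big_cat_nat (n := (j %/ k.+1).+1)) //=; last first.
  by rewrite ltnS (leq_trans (leq_div _ _) jM).
rewrite [X in _ = _ + X]big1_seq ?addr0 // => i.
rewrite mem_index_iota /= => /andP[ji _].
rewrite ['C(r + j - _, _)]bin_small ?mulr0 //.
have i0 : (0 < i)%N by case: (i) ji.
have : (j < i * k.+1)%N by rewrite -ltn_divLR.
by rewrite (mulnS i k); lia.
Qed.

(** Pascal's rule in the second factor on the left, then, on one of the two
resulting terms, in the first factor.  The test [k <= j] comes from the delay
by [k.+1], and the identity survives the truncated subtractions since every
binomial coefficient that is affected by them is zero. *)
Lemma run_binomial r i j k :
  ('C(r.+1 + i.+1, r.+1) * 'C(r.+1 + j.+1 - i.+1 * k, r.+1 + i.+1) =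
   'C(r.+1 + i.+1, r.+1) * 'C(r.+1 + j - i.+1 * k, r.+1 + i.+1) +
   'C(r.+1 + i, r.+1) *
     (if k <= j then 'C(r.+1 + (j - k) - i * k, r.+1 + i) else 0) +
   'C(r + i.+1, r) * 'C(r + j.+1 - i.+1 * k, r + i.+1))%N.
Proof.
have -> : (if k <= j then 'C(r.+1 + (j - k) - i * k, r.+1 + i) else 0)%N =
          'C(r.+1 + j - i.+1 * k, r.+1 + i).
  case: leqP => kj; first by congr 'C(_, _); rewrite mulSn; lia.
  by rewrite bin_small // mulSn; lia.
have [le|lt] := leqP (i.+1 * k) (r.+1 + j); last first.
  have -> : (r.+1 + j.+1 - i.+1 * k = 0)%N by lia.
  have -> : (r.+1 + j - i.+1 * k = 0)%N by lia.
  have -> : (r + j.+1 - i.+1 * k = 0)%N by lia.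
  by rewrite !addSn !addnS !bin0n !muln0.
have -> : (r.+1 + j.+1 - i.+1 * k = (r.+1 + j - i.+1 * k).+1)%N by lia.
rewrite !addSn !addnS -addSn; move: (_ - _)%N => m.
by rewrite !binS !addSn; ring.
Qed.

(** The previous identity with [r.+1] replaced by 0; its last term is absent. *)
Lemma run_binomial0 i j k :
  ('C(j.+1 - i.+1 * k, i.+1) = 'C(j - i.+1 * k, i.+1) +
     (if k <= j then 'C(j - k - i * k, i) else 0))%N.
Proof.
case: leqP => kj; last first.
  by rewrite !bin_small ?mulSn //; lia.
have -> : (j - k - i * k = j - i.+1 * k)%N by rewrite mulSn; lia.
have [le|lt] := leqP (i.+1 * k) j; first by rewrite subSn // binS addnC.
have -> : (j.+1 - i.+1 * k = 0)%N by lia.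
have -> : (j - i.+1 * k = 0)%N by lia.
by case: i lt => [|i]; rewrite ?bin0n // mul1n ltnNge kj.
Qed.

(** Multiplying (1 - X + x X^(k+1))^(-(r+1)) by its base lowers the exponent. *)
Lemma runop_runcoef k x r : runop k x (runcoef k x r.+1) = runcoef k x r.
Proof.
apply/funext => -[|j]; rewrite /runop !fctE iter_delayE.
  rewrite -[delay _ 0%N]/0 scaler0 addr0 subr0.
  rewrite (runcoef_widen _ _ _ (leqnn 0)) big_nat1.
  rewrite mul0n subn0 !addn0 !binn !mulr1 expr0.
  case: r => [|r] //; rewrite (runcoef_widen _ _ _ (leqnn 0)) big_nat1.
  by rewrite mul0n subn0 !addn0 !binn !mulr1 expr0.
rewrite ltnS subSS -[delay _ j.+1]/(runcoef k x r.+1 j).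
rewrite (runcoef_widen _ _ _ (leqnn j.+1)).
rewrite (runcoef_widen _ _ _ (leqnSn j)).
have -> : (if (k <= j)%N then runcoef k x r.+1 (j - k)%N else 0) =
  \sum_(0 <= i < j.+1) (- x) ^+ i * 'C(r + i, r)%:R *
    (if k <= j then 'C(r + (j - k) - i * k, r + i) else 0)%N%:R.
  case: ifP => kj; last by rewrite big1 // => i _; rewrite mulr0.
  exact/runcoef_widen/leq_subr.
rewrite -[_ *: _]/(x * _) mulr_sumr -sumrB.
rewrite big_nat_recl // -addrA -big_split /= mul0n !subn0 !addn0 !binn.
rewrite !expr0 !mul1r.
case: r => [|r].
  rewrite !bin0 subrr add0r big1 // => i _.
  rewrite !add0n run_binomial0 natrD exprS !bin0.
  move: ((- x) ^+ i) (_%:R) ((if _ then _ else _)%:R) => y b c; ring.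
rewrite (runcoef_widen _ _ _ (leqnn j.+1)) [RHS]big_nat_recl //.
rewrite mul0n !subn0 !addn0 !binn expr0 !mul1r; congr (_ + _).
  by rewrite addnS addSn binS natrD addrC addKr -addSn addSnnS.
apply: eq_bigr => i _; rewrite exprS; move: ((- x) ^+ i) (run_binomial r i j k).
move: 'C(r.+1 + i.+1, r.+1) 'C(r.+1 + j.+1 - _, _) 'C(r.+1 + j - _, _) => a b c.
move: 'C(r.+1 + i, r.+1) (if _ then _ else _) 'C(r + i.+1, r) => d e f.
move: 'C(r + j.+1 - _, _) => g y /(congr1 (fun m => m%:R : R)).
rewrite !natrD !natrM => E.
by rewrite -[_ * b%:R]mulrA E; ring.
Qed.

(** The coefficients of ((1 - p X) / (1 - X + x X^(k+1)))^r. *)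
Definition nbcoef k p x r : seqR := iter r (damp p) (runcoef k x r).

Lemma runop_iter_damp k x p m f :
  runop k x (iter m (damp p) f) = iter m (damp p) (runop k x f).
Proof. by elim: m => //= m IH; rewrite runop_damp IH. Qed.

Lemma runop_nbcoef k p x r :
  runop k x (nbcoef k p x r.+1) = damp p (nbcoef k p x r).
Proof. by rewrite runop_iter_damp runop_runcoef. Qed.

Lemma nb_recurrence_sol k p x c (F : nat -> seqR) : F 0%N = delta ->
  (forall r, runop k x (F r.+1) = p ^+ k *: iter k delay (damp p (F r))) ->
  F c = p ^+ (c * k) *: iter (c * k) delay (nbcoef k p x c).
Proof.
move=> F0 FS; elim: c => [|c IH]; first by rewrite F0 mul0n expr0 scale1r.
apply: (@runop_inj k x); rewrite FS IH runopZ runop_iter_delay runop_nbcoef.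
rewrite /damp !(delayZ, iter_delay_lin) delay_iterC -!iterD -mulSn -iterSr.
rewrite [RHS]scalerBr [LHS]scalerBr !scalerA -!exprD mulSn.
by rewrite mulrCA -exprD [_ * p]mulrC.
Qed.

End Delay.

(** * Binomial moments of geometrically small sequences *)

(** Write T m M for the sum.  Moving the summation range by [K] and expanding
'C(N + K, m) by Vandermonde's identity bounds T m by a constant plus [rho] times
(T m + a combination of the T j with j < m).  As [rho < 1], T m can be moved to
the left, and induction on [m] bounds the rest. *)
Lemma sum_bin_le_geometric (R : realFieldType) (h : nat -> R) K rho m :
  0 <= rho -> rho < 1 -> (forall N, 0 <= h N) ->
  (forall N, h (K + N)%N <= rho * h N) ->
  exists C, forall M, \sum_(0 <= N < M) 'C(N, m)%:R * h N <= C.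
Proof.
move=> rho0 rho1 h0 hK; pose T j M := \sum_(0 <= N < M) 'C(N, j)%:R * h N.
suff [C TC] : exists C, forall j M, (j < m.+1)%N -> T j M <= C.
  by exists C => M; apply: TC.
elim: m.+1 => [|{}m [C TC]]; first by exists 0.
pose C' := (T m K + rho * \sum_(i < m) 'C(K, i.+1)%:R * C) / (1 - rho).
have TC' M : T m M <= C'.
  have r1 : 0 < 1 - rho by lra.
  rewrite ler_pdivlMr // mulrBr mulr1 lerBlDr -addrA.
  have leM : T m M <= T m (K + M)%N.
    rewrite /T (@big_cat_nat _ _ _ M 0 (K + M)) ?leq_addl //= lerDl.
    by apply: sumr_ge0 => N _; rewrite mulr_ge0.
  apply: (le_trans leM); rewrite /T (@big_cat_nat _ _ _ K 0) ?leq_addr //=.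
  rewrite lerD2l -{1}[K]add0n big_addn addKn.
  rewrite -/(T m M) [_ * rho]mulrC -mulrDr [_ + T m M]addrC.
  have -> : T m M + \sum_(i < m) 'C(K, i.+1)%:R * C =
    \sum_(i < m.+1) 'C(K, i)%:R * (if i == 0%N :> nat then T m M else C).
    by rewrite big_ord_recl bin0 mul1r.
  have : \sum_(i < m.+1) 'C(K, i)%:R * T (m - i)%N M <=
    \sum_(i < m.+1) 'C(K, i)%:R * (if i == 0%N :> nat then T m M else C).
    apply: ler_sum => -[[|i] /= im] _; rewrite ?subn0 // ler_wpM2l //.
    by apply: TC; rewrite subnS prednK ?leq_subr // subn_gt0.
  move/(ler_wpM2l rho0); apply: le_trans.
  under [X in _ <= _ * X]eq_bigr do rewrite mulr_sumr.
  rewrite exchange_big mulr_sumr /=; apply: ler_sum => N _.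
  under [X in _ <= _ * X]eq_bigr do rewrite mulrA -natrM.
  rewrite -mulr_suml -natr_sum binomial.Vandermonde [(N + K)%N]addnC mulrCA.
  by rewrite ler_wpM2l.
exists (Num.max C C') => j M; rewrite ltnS leq_eqVlt => /orP[/eqP-> | /TC lt].
  by rewrite le_max TC' orbT.
by rewrite le_max lt.
Qed.

Lemma sum_bin_by_parts (R : comNzRingType) (h : nat -> R) n M :
  \sum_(0 <= N < M) 'C(N.+1, n.+1)%:R * (h N - h N.+1) =
  \sum_(0 <= N < M) 'C(N, n)%:R * h N - 'C(M, n.+1)%:R * h M.
Proof.
elim: M => [|M IH]; first by rewrite !big_nil bin0n mul0r subr0.
by rewrite !big_nat_recr //= IH binS natrD; ring.
Qed.

Lemma cvg_sum_bin_by_parts (R : realType) (h : nat -> R) K rho n :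
  0 <= rho -> rho < 1 -> (forall N, 0 <= h N) ->
  (forall N, h (K + N)%N <= rho * h N) ->
  exists L : R,
   [/\ (fun M => \sum_(0 <= N < M) 'C(N, n)%:R * h N) @ \oo --> L
    & (fun M => \sum_(0 <= N < M) 'C(N.+1, n.+1)%:R * (h N - h N.+1)) @ \oo
         --> L].
Proof.
move=> rho0 rho1 h0 hK.
have cv m : cvgn (series (fun N => 'C(N, m)%:R * h N)).
  apply: nondecreasing_is_cvgn.
    by apply: nondecreasing_series => i _ _; rewrite mulr_ge0.
  have [C hC] := sum_bin_le_geometric m rho0 rho1 h0 hK.
  by exists C => _ [M _ <-]; exact: hC.
exists (limn (series (fun N => 'C(N, n)%:R * h N))); split; first exact: cv.
under eq_fun do rewrite sum_bin_by_parts.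
set L := limn _; rewrite -[L]subr0; apply: cvgB; first exact: cv.
exact: cvg_series_cvg_0 (cv n.+1).
Qed.

(** * Runs in a record of trials *)

Section Runs.
Variable k : nat.
Implicit Types (x y : nat -> bool) (N M m c s : nat).

Lemma run_stateS x m : run_state k x m.+1 =
  if x m then
    if (run_state k x m).2.+1 == k then ((run_count k x m).+1, 0%N)
    else (run_count k x m, (run_state k x m).2.+1)
  else (run_count k x m, 0%N).
Proof. by rewrite /run_count /=; case: run_state. Qed.

Lemma eq_run_state x y m : (forall i, (i < m)%N -> x i = y i) ->
  run_state k x m = run_state k y m.
Proof.
elim: m => // m IH xy; rewrite !run_stateS /run_count IH ?xy // => i im.
exact/xy/ltnW.
Qed.

Lemma eq_run_count x y m : (forall i, (i < m)%N -> x i = y i) ->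
  run_count k x m = run_count k y m.
Proof. by move=> xy; rewrite /run_count (eq_run_state xy). Qed.

Lemma streak_lt x m : (0 < k)%N -> ((run_state k x m).2 < k)%N.
Proof.
move=> k_gt0; elim: m => // m IH; rewrite run_stateS.
case: ifP => //; case: ifP => //=.
by move=> /negbT; rewrite ltn_neqAle IH andbT.
Qed.

Lemma run_countS x m : run_count k x m.+1 =
  (run_count k x m + (x m && ((run_state k x m).2.+1 == k)))%N.
Proof.
rewrite {1}/run_count run_stateS.
by case: (x m) => /=; [case: ifP|]; rewrite /= ?addn1 ?addn0.
Qed.

Lemma run_count_homo x : {homo run_count k x : m n / (m <= n)%N}.
Proof. by apply: homo_leq leq_trans _ => // m; rewrite run_countS leq_addr. Qed.

Lemma run_length_le x m :
  (run_count k x m * k + (run_state k x m).2 <= m)%N.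
Proof.
elim: m => // m; rewrite {2}/run_count run_stateS => IH.
case: ifP => xm; [case: eqP => sk|] => /=; lia.
Qed.

(** During a block of successes, the total length of counted runs and current
streak grows by one at each trial, whether or not a run is completed. *)
Lemma run_length_all x N m : (forall i, (i < m)%N -> x (N + i)%N) ->
  (run_count k x (N + m) * k + (run_state k x (N + m)).2 =
   run_count k x N * k + (run_state k x N).2 + m)%N.
Proof.
elim: m => [|m IH] hx; first by rewrite !addn0.
have {}IH := IH (fun i im => hx i (ltnW im)).
rewrite addnS {1}/run_count run_stateS hx //; case: eqP => sk /=;
  rewrite ?mulSn; move: IH;
  by move: (run_count k x N * k)%N (run_count k x (N + m) * k)%N => a b; lia.
Qed.

Lemma run_count_all x N r : (0 < k)%N ->
  (forall i, (i < r * k)%N -> x (N + i)%N) ->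
  (r <= run_count k x (N + r * k))%N.
Proof.
move=> k_gt0 /run_length_all E.
rewrite -ltnS -(ltn_pmul2r k_gt0) mulSn.
by have := streak_lt x (N + r * k) k_gt0; lia.
Qed.

Lemma run_state_eqS x m c s : (s.+1 < k)%N ->
  (run_state k x m.+1 == (c, s.+1)) = (run_state k x m == (c, s)) && x m.
Proof.
move=> sk; rewrite run_stateS /run_count; case: run_state => c' s' /=.
case: (x m); last by rewrite xpair_eqE andbF andbF.
rewrite andbT; case: (s'.+1 =P k) => [s'k|_]; last by rewrite !xpair_eqE.
by rewrite !xpair_eqE andbF; apply/esym/negbTE/negP => /andP[_ /eqP]; lia.
Qed.

(** The streak just before a completion has length [k.-1], so the
completion of run number [c.+1] fixes the whole state before it. *)
Lemma run_completed x m c : (0 < k)%N ->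
  (run_count k x m < c.+1 <= run_count k x m.+1)%N =
  (run_state k x m == (c, k.-1)) && x m.
Proof.
move=> k_gt0; rewrite run_countS /run_count; case: run_state => c' s' /=.
rewrite xpair_eqE; case: (x m) => /=; last by rewrite addn0 andbF; lia.
rewrite andbT -[s' == _]eqSS prednK //; case: eqP => _ /=; lia.
Qed.

(** A streak is zero either because a run has just been counted or because the
last trial failed. *)
Lemma run_restart x m c :
  (run_state k x m.+1 == (c, 0)%N) =
  (run_count k x m < c <= run_count k x m.+1)%N
    || ((run_count k x m == c) && ~~ x m).
Proof.
rewrite run_countS run_stateS /run_count; case: run_state => c' s' /=.
by case: (x m) => /=; [case: (s'.+1 =P k) => _ /=|]; rewrite xpair_eqE /=; lia.
Qed.

End Runs.

(** * Independent trials *)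

Definition determined N (phi : (nat -> bool) -> bool) :=
  forall x y, (forall i, (i < N)%N -> x i = y i) -> phi x = phi y.

Lemma determined_le M N phi :
  (M <= N)%N -> determined M phi -> determined N phi.
Proof. by move=> MN dphi x y xy; apply: dphi => i /leq_trans/(_ MN)/xy. Qed.

Section Trials.
Context (R : realType) (d : measure_display) (T : measurableType d).
Variables (P : probability T R) (p : R) (X : nat -> {RV P >-> bool}).
Hypothesis hindep : mutually_independent P (fun i => X i : T -> bool).
Hypothesis hX : forall i, P [set w | X i w = true] = p%:E.

Definition event (phi : (nat -> bool) -> bool) : set T :=
  [set w | phi (fun i => X i w)].

Local Notation cyl J B := (\bigcap_(i in [set` J]) (X i @^-1` B i)).

Lemma measurable_trial i (B : set bool) : measurable (X i @^-1` B).
Proof. by rewrite -[_ @^-1` _]setTI; apply: measurable_funPT. Qed.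

Lemma measurable_cyl (J : {fset nat}) (B : nat -> set bool) :
  measurable (cyl J B).
Proof.
by apply: fin_bigcap_measurable => // i _; apply: measurable_trial.
Qed.

(** An event that depends on the first [N] trials is independent of all
cylinders over later trials.  Conditioning on trial number [N] splits an event
determined by [N.+1] trials into two events determined by [N] trials,
intersected with a cylinder to which trial [N] has been added; so the induction
needs the statement for cylinders over arbitrary finite sets. *)
Lemma determined_indep N phi : determined N phi ->
  measurable (event phi) /\
  forall (J : {fset nat}) (B : nat -> set bool),
    (forall j, j \in J -> (N <= j)%N) ->
    P (event phi `&` cyl J B) =
    (P (event phi) * \prod_(i <- J) P (X i @^-1` B i))%E.
Proof.
elim: N phi => [|N IH] phi dphi.
  have [phi1|phi0] := boolP (phi xpredT).
    have -> : event phi = setT.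
      by apply/seteqP; split => // w _; rewrite /event /= (dphi _ xpredT).
    split => // J B _; rewrite setTI probability_setT mul1e.
    exact: hindep.
  have -> : event phi = set0.
    apply/seteqP; split => // w.
    by rewrite /event /= (dphi _ xpredT) // (negbTE phi0).
  by split => // J B _; rewrite set0I measure0 mul0e.
(* phi_ b is phi with the outcome of trial N replaced by b. *)
pose phi_ b x := phi (fun i => if i == N then b else x i).
have dphi_ b : determined N (phi_ b).
  move=> x y xy; apply: dphi => i; rewrite ltnS leq_eqVlt.
  by case: eqP => //= _; exact: xy.
have m_ b := (IH _ (dphi_ b)).1.
have indep_ b := (IH _ (dphi_ b)).2.
pose E b := event (phi_ b) `&` X N @^-1` [set b].
have mE b : measurable (E b).
  by apply: measurableI => //; exact: measurable_trial.
have phiE : event phi = E true `|` E false.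
  have phi_E w b : X N w = b -> phi (X ^~ w) = phi_ b (X ^~ w).
    by move=> <-; congr phi; apply/funext => i; case: eqP => // ->.
  apply/seteqP; split => w; last first.
    by move=> [] [+ /phi_E E_w]; rewrite /event /= -E_w.
  case XN: (X N w) => phiw; [left|right]; split => //=; rewrite /event /=.
    by rewrite -(phi_E _ _ XN).
  by rewrite -(phi_E _ _ XN).
have split_ G : measurable G -> P (event phi `&` G) =
    (P (E true `&` G) + P (E false `&` G))%E.
  move=> mG; rewrite phiE setIUl measureU //; try exact: measurableI.
  apply/seteqP; split => // w [[[_ /= Xt] _] [[_ /= Xf] _]].
  by rewrite Xt in Xf.
have cyl_ b (J : {fset nat}) B : (forall j, j \in J -> (N < j)%N) ->
    P (E b `&` cyl J B) = (P (event (phi_ b)) *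
      (P (X N @^-1` [set b]) * \prod_(i <- J) P (X i @^-1` B i)))%E.
  move=> NJ; pose B' i := if i == N then [set b] else B i.
  have NJ' : N \notin J by apply/negP => /NJ; rewrite ltnn.
  have JN i : i \in J -> (i == N) = false.
    by move=> iJ; apply/eqP => iN; rewrite -iN iJ in NJ'.
  have -> : E b `&` cyl J B = event (phi_ b) `&` cyl (N |` J)%fset B'.
    rewrite /E -setIA; congr (_ `&` _); apply/seteqP; split => w.
      move=> [wN wJ] i /=; rewrite in_fset1U /B'; case: eqP => [-> //|_ /=].
      exact: wJ.
    move=> wJ; split.
      by have := wJ N; rewrite /= in_fset1U /B' eqxx; apply.
    move=> i /= iJ; have := wJ i; rewrite /= in_fset1U iJ orbT /B' JN //.
    exact.
  rewrite indep_; last first.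
    by move=> j; rewrite in_fset1U => /orP[/eqP-> //|/NJ/ltnW].
  rewrite big_fsetU1 //= {1}/B' eqxx; congr (_ * (_ * _))%E.
  by apply: eq_big_seq => i iJ; rewrite /B' JN.
have mphi : measurable (event phi) by rewrite phiE; exact: measurableU.
split=> // J B NJ; rewrite split_; last exact: measurable_cyl.
rewrite !cyl_ // -[event phi in RHS]setIT split_ //.
have cyl0 b : P (E b `&` setT) =
    (P (event (phi_ b)) * P (X N @^-1` [set b]))%E.
  have := cyl_ b fset0 (fun=> setT).
  by rewrite big_seq_fset0 mule1 set_fset0 bigcap_set0; apply.
by rewrite !cyl0 !muleA ge0_muleDl ?mule_ge0.
Qed.

Lemma measurable_event N phi : determined N phi -> measurable (event phi).
Proof. by move=> /determined_indep[]. Qed.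

Definition prob phi : R := fine (P (event phi)).

Lemma probE N phi : determined N phi -> P (event phi) = (prob phi)%:E.
Proof.
by move=> /measurable_event mphi; rewrite fineK // fin_num_measure.
Qed.

Lemma prob_ge0 phi : 0 <= prob phi.
Proof. exact: fine_ge0. Qed.

Lemma eq_prob phi psi : phi =1 psi -> prob phi = prob psi.
Proof. by move=> /funext->. Qed.

Lemma prob_true : prob xpredT = 1.
Proof.
have -> : prob xpredT = fine (P setT).
  by congr (fine (P _)); apply/seteqP; split.
by rewrite probability_setT.
Qed.

Lemma prob_false : prob xpred0 = 0.
Proof.
have -> : prob xpred0 = fine (P set0).
  by congr (fine (P _)); apply/seteqP; split.
by rewrite measure0.
Qed.

Lemma prob_orb N phi psi : determined N phi -> determined N psi ->
  (forall x, phi x -> ~~ psi x) ->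
  prob (fun x => phi x || psi x) = prob phi + prob psi.
Proof.
move=> dphi dpsi disj.
have -> : prob (fun x => phi x || psi x) = fine (P (event phi `|` event psi)).
  by rewrite /prob; congr (fine (P _)); apply/seteqP; split => w /orP.
have [mphi mpsi] := (measurable_event dphi, measurable_event dpsi).
rewrite measureU ?fineD ?fin_num_measure //.
by apply/seteqP; split => // w [/disj/negP].
Qed.

Lemma prob_split N phi psi : determined N phi -> determined N psi ->
  prob phi = prob (fun x => phi x && psi x) + prob (fun x => phi x && ~~ psi x).
Proof.
move=> dphi dpsi; rewrite -(@prob_orb N).
- by apply: eq_prob => x; rewrite -andb_orr orbN andbT.
- by move=> x y xy; rewrite (dphi x y) ?(dpsi x y).
- by move=> x y xy; rewrite (dphi x y) ?(dpsi x y).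
- by move=> x /andP[-> ->].
Qed.

Lemma prob_le N phi psi : determined N phi -> determined N psi ->
  (forall x, phi x -> psi x) -> prob phi <= prob psi.
Proof.
move=> dphi dpsi sub; rewrite (prob_split dpsi dphi).
rewrite [X in _ <= X + _](eq_prob (psi := phi)) ?lerDl ?prob_ge0 // => x.
by case: (phi x) (sub x) => [->|_] //; rewrite andbF.
Qed.

Lemma prob_success N phi : determined N phi ->
  prob (fun x => phi x && x N) = p * prob phi.
Proof.
move=> /determined_indep[mphi /(_ [fset N]%fset (fun=> [set true]))].
have -> : event phi `&` cyl [fset N]%fset (fun=> [set true]) =
          event (fun x => phi x && x N).
  apply/seteqP; split => w /=.
    move=> [pw /(_ N)]; rewrite /= in_fset1 eqxx => /(_ isT) /= XN.
    exact/andP.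
  by move=> /andP[pw XN]; split => // i /=; rewrite in_fset1 => /eqP->.
rewrite big_seq_fset1 /prob => ->; last by move=> j; rewrite in_fset1 => /eqP->.
rewrite [P (X N @^-1` _)]hX muleC fineM //; exact: fin_num_measure.
Qed.

Lemma prob_failure N phi : determined N phi ->
  prob (fun x => phi x && ~~ x N) = (1 - p) * prob phi.
Proof.
move=> dphi; have dN : determined N.+1 (fun x => x N) by move=> x y; apply.
have := prob_split (determined_le (leqnSn N) dphi) dN.
rewrite (prob_success dphi) => E.
by rewrite mulrBl mul1r [X in _ = X - _]E addrC addKr.
Qed.

Lemma prob_successes N m phi : determined N phi ->
  prob (fun x => phi x && [forall i : 'I_m, x (N + i)%N]) = p ^+ m * prob phi.
Proof.
move=> dphi; elim: m => [|m IH].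
  rewrite mul1r; apply: eq_prob => x.
  have -> : [forall i : 'I_0, x (N + i)%N] by apply/forallP => -[].
  by rewrite andbT.
rewrite exprS -mulrA -IH -(@prob_success (N + m)).
  apply: eq_prob => x; rewrite -andbA; congr (_ && _).
  apply/forallP/andP => [h|[/forallP h hm] i].
    by split; [apply/forallP => i; have := h (widen_ord (leqnSn m) i)|
      have := h ord_max].
  have := ltn_ord i; rewrite ltnS leq_eqVlt => /orP[/eqP-> //|im].
  exact: (h (Ordinal im)).
move=> x y xy; congr (_ && _); first by apply: dphi => i iN; apply: xy; lia.
by apply: eq_forallb => i; apply: xy; rewrite ltn_add2l.
Qed.

End Trials.

(** * Law of the waiting time *)

Section WaitingTimeLaw.
Context (R : realType) (d : measure_display) (T : measurableType d).
Variables (P : probability T R) (p : R) (X : nat -> {RV P >-> bool}).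
Hypothesis hindep : mutually_independent P (fun i => X i : T -> bool).
Hypothesis hX : forall i, P [set w | X i w = true] = p%:E.
Variables (k : nat) (k_gt0 : (0 < k)%N).
Local Notation seqR := (nat -> R^o).
Local Notation prob := (prob X).

Lemma determined_state N (g : nat * nat -> bool) :
  determined N (fun x => g (run_state k x N)).
Proof. by move=> x y /eq_run_state ->. Qed.

Lemma determined_count M N (g : nat -> bool) : (M <= N)%N ->
  determined N (fun x => g (run_count k x M)).
Proof.
move=> MN; apply: determined_le MN _.
exact: (@determined_state M (fun s => g s.1)).
Qed.

(** The probability that the waiting time for run number [c] exceeds [N]. *)
Definition wait_tail c : seqR := fun N => prob (fun x => run_count k x N < c)%N.

(** The probability that run number [c] is completed exactly at trial [N]
([wait_pmfS]), as the backward difference of the distribution function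
1 - [wait_tail c]; [delta R] is the backward difference of the constant 1. *)
Definition wait_pmf c : seqR := delta R - (wait_tail c - delay (wait_tail c)).

Definition count_pmf c : seqR := wait_tail c.+1 - wait_tail c.

(** The probability that the counting starts from scratch after trial [N], with
[c] runs counted. *)
Definition restart_prob c : seqR := fun N =>
  prob (fun x => run_state k x N == (c, 0)%N).

Lemma count_pmfE c N : count_pmf c N = prob (fun x => run_count k x N == c).
Proof.
rewrite /count_pmf /wait_tail !fctE.
have dN g := @determined_count N N g (leqnn N).
rewrite (prob_split hindep (dN (fun n => n < c.+1)%N) (dN (fun n => n < c)%N)).
rewrite [X in X + _ - _](eq_prob _ (psi := fun x => (run_count k x N < c)%N)).
  by rewrite addrC addKr; apply: eq_prob => x /=; lia.
by move=> x /=; lia.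
Qed.

Lemma wait_pmfS c N :
  wait_pmf c N.+1 = prob (fun x => run_count k x N < c <= run_count k x N.+1)%N.
Proof.
rewrite /wait_pmf /wait_tail !fctE /= sub0r opprB.
apply/eqP; rewrite subr_eq; apply/eqP.
have dN := @determined_count N N.+1 (fun n => n < c)%N (leqnSn N).
have dN1 := @determined_count N.+1 N.+1 (fun n => n < c)%N (leqnn _).
rewrite (prob_split hindep dN dN1) addrC.
congr (_ + _); apply: eq_prob => x; first by rewrite -leqNgt.
by have := run_countS k x N; lia.
Qed.

Lemma wait_pmf_eq0 c N : (N < k)%N -> wait_pmf c.+1 N = 0.
Proof.
have tail1 M : (M < k)%N -> wait_tail c.+1 M = 1.
  move=> Mk; rewrite -(prob_true X); apply: eq_prob => x.
  have := run_length_le k x M; rewrite ltnS.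
  by case: run_count => //= n; rewrite mulSn; lia.
rewrite /wait_pmf !fctE; case: N => [|N] Nk /=.
  by rewrite tail1 // subr0 subrr.
by rewrite !tail1 ?(ltnW Nk) // !subrr.
Qed.

Lemma prob_streak c N s : (s < k)%N ->
  prob (fun x => run_state k x (N + s) == (c, s)) = p ^+ s * restart_prob c N.
Proof.
elim: s => [|s IH] sk; first by rewrite addn0 mul1r.
rewrite exprS -mulrA -(IH (ltnW sk)) addnS.
rewrite -(prob_success hindep hX (@determined_state _ (pred1 (c, s)))).
by apply: eq_prob => x; rewrite run_state_eqS.
Qed.

(** Run number [c.+1] is completed at [N + k] exactly when the counting restarts
at [N] with [c] runs and the next [k] trials succeed. *)
Lemma wait_pmf_restart c :
  wait_pmf c.+1 = p ^+ k *: iter k (@delay R) (restart_prob c).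
Proof.
apply/funext => N; rewrite !fctE iter_delayE.
case: leqP => [kN|/wait_pmf_eq0->].
  rewrite -{1}(subnK kN); move: (N - k)%N => M.
  rewrite -{1}(prednK k_gt0) addnS wait_pmfS.
  rewrite (eq_prob X (psi := fun x => (run_state k x (M + k.-1) == (c, k.-1)) &&
     x (M + k.-1)%N)); last by move=> x; exact: run_completed.
  rewrite (prob_success hindep hX (@determined_state _ (pred1 (c, k.-1)))).
  by rewrite prob_streak ?ltn_predL // mulrA -exprS prednK.
by rewrite scaler0.
Qed.

Lemma restart_probE c :
  restart_prob c = wait_pmf c + (1 - p) *: delay (count_pmf c).
Proof.
apply/funext => -[|N]; rewrite !fctE.
  rewrite [delay (count_pmf c) _]/= scaler0 addr0 /wait_pmf !fctE /= subr0.
  rewrite /restart_prob /wait_tail /=; case: c => [|c].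
    rewrite -[prob _]/(prob xpredT) -[X in _ - X]/(prob xpred0).
    by rewrite prob_true prob_false subr0.
  rewrite -[prob _]/(prob xpred0) -[X in _ - X]/(prob xpredT).
  by rewrite prob_true prob_false subrr.
rewrite wait_pmfS -[_ *: _]/((1 - p) * count_pmf c N) count_pmfE.
have dN := @determined_count N N (pred1 c) (leqnn _).
rewrite -(prob_failure hindep hX dN) -(prob_orb hindep (N := N.+1)).
- by apply: eq_prob => x; exact: run_restart.
- move=> x y xy.
  by rewrite !(eq_run_count k (y := y)) // => i iN; exact/xy/ltnW.
- move=> x y xy.
  by rewrite xy // (eq_run_count k (y := y)) // => i iN; exact/xy/ltnW.
- by move=> x /andP[lt _]; rewrite /= (ltn_eqF lt).
Qed.

(** [count_pmf c] is eliminated by applying [1 - delay], because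
(1 - delay) (count_pmf c) = wait_pmf c - wait_pmf c.+1. *)
Lemma wait_pmf_recurrence c : runop k ((1 - p) * p ^+ k) (wait_pmf c.+1) =
  p ^+ k *: iter k (@delay R) (damp p (wait_pmf c)).
Proof.
have count_diff :
    count_pmf c - delay (count_pmf c) = wait_pmf c - wait_pmf c.+1.
  rewrite /wait_pmf /count_pmf delayD delayN.
  by apply/funext => n; rewrite !fctE; ring.
have restart_diff : restart_prob c - delay (restart_prob c) =
    damp p (wait_pmf c) - (1 - p) *: delay (wait_pmf c.+1).
  rewrite restart_probE (delayD (wait_pmf c)) delayZ opprD addrACA -scalerBr.
  rewrite -(delayN (delay _)) -(delayD (count_pmf c)) count_diff.
  rewrite (delayD (wait_pmf c)) (delayN (wait_pmf c.+1)) /damp.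
  apply/funext => n; rewrite !fctE.
  rewrite -![_ *: _]/(_ * _); ring.
rewrite /runop.
move: (wait_pmf c.+1) (restart_prob c) (damp p (wait_pmf c))
  (wait_pmf_restart c) restart_diff => W U D WE UE.
rewrite {1 2}WE delayZ delay_iterC -scalerBr -iter_delayN -iter_delayD UE.
rewrite !iter_delay_lin -delay_iterC scalerBr scalerA.
by rewrite [p ^+ k * _]mulrC subrK.
Qed.

Lemma wait_pmfE c : wait_pmf c =
  p ^+ (c * k) *: iter (c * k) (@delay R) (nbcoef k p ((1 - p) * p ^+ k) c).
Proof.
apply: nb_recurrence_sol => [|r]; last exact: wait_pmf_recurrence.
rewrite /wait_pmf.
have -> : wait_tail 0 = 0 by apply/funext => N; exact: prob_false.
by apply/funext => -[|n]; rewrite !fctE /= !subr0.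
Qed.

(** If the next [r * k] trials all succeed, then [r] runs are completed during
them; this has probability [p ^+ (r * k)] whatever happened before. *)
Lemma wait_tail_geometric r N :
  wait_tail r (r * k + N)%N <= (1 - p ^+ (r * k)) * wait_tail r N.
Proof.
have dN := @determined_count N N (fun n => n < r)%N (leqnn _).
have dN' : determined (r * k + N) (fun x =>
    (run_count k x N < r)%N && [forall i : 'I_(r * k), x (N + i)%N]).
  move=> x y xy; congr (_ && _); first by apply: dN => i iN; apply: xy; lia.
  by apply: eq_forallb => i; apply: xy; have := ltn_ord i; lia.
have dNr := @determined_count _ _ (fun n => n < r)%N (leqnn (r * k + N)).
rewrite mulrBl mul1r lerBrDr -(prob_successes hindep hX _ dN).
have disj x : (run_count k x (r * k + N) < r)%N ->
    ~~ ((run_count k x N < r)%N && [forall i : 'I_(r * k), x (N + i)%N]).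
  apply: contraTN => /andP[_ /forallP xall]; rewrite -leqNgt addnC.
  by apply: run_count_all => // i ir; exact: (xall (Ordinal ir)).
rewrite -(prob_orb hindep dNr dN' disj).
apply: (prob_le hindep (N := (r * k + N)%N)).
- by move=> x y xy; rewrite (dNr x y) // (dN' x y).
- exact/(determined_le _ dN)/leq_addl.
move=> x /orP[|/andP[]//]; apply: leq_ltn_trans.
by rewrite run_count_homo ?leq_addl.
Qed.

End WaitingTimeLaw.

(** * Factorial moments *)

Lemma hockey_stick n M : (\sum_(0 <= N < M) 'C(N, n) = 'C(M, n.+1))%N.
Proof.
elim: M => [|M IH]; first by rewrite big_nil bin0n.
by rewrite big_nat_recr //= IH binS.
Qed.

Lemma prod_subr_ffact (R : comNzRingType) (m n : nat) :
  \prod_(i < n) (m%:R - i%:R) = (m ^_ n)%:R :> R.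
Proof.
elim: n => [|n IH]; first by rewrite big_ord0.
rewrite big_ord_recr /= IH ffactnSr natrM.
have [nm|mn] := leqP n m; first by rewrite natrB.
by rewrite ffact_small // !mul0r.
Qed.

Lemma waiting_time_fin (R : realType) k r x m : (r <= run_count k x m)%N ->
  (forall j, (r <= run_count k x j)%N -> (m <= j)%N) ->
  waiting_time R k r x = m%:R%:E.
Proof.
move=> hm minm; apply/eqP; rewrite eq_le; apply/andP; split.
  by apply: ereal_inf_lbound; exists m.
by apply: le_ereal_inf_tmp => _ [j /minm mj <-]; rewrite lee_fin ler_nat.
Qed.

Lemma waiting_time_pinfty (R : realType) k r x :
  (forall m, (run_count k x m < r)%N) -> waiting_time R k r x = +oo%E.
Proof.
move=> none; rewrite /waiting_time -[RHS]ereal_inf0; congr ereal_inf.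
by apply/seteqP; split => // _ [m /= rm _]; move: rm; rewrite leqNgt none.
Qed.

(** For a finite waiting time [m] the product is (n+1)! 'C(m, n+1), and
'C(m, n+1) is the sum of the 'C(N, n) over N < m.  If fewer than [r] runs ever
occur, both sides are infinite; this is where at least one factor is needed,
the empty product being 1. *)
Lemma ffact_waiting_time (R : realType) k r n (x : nat -> bool) :
  (\prod_(m < n.+1) (waiting_time R k r x - m%:R%:E) =
   \sum_(0 <= N <oo) ((n.+1)`!%:R * 'C(N, n)%:R *
                      (run_count k x N < r)%:R)%:E)%E.
Proof.
have f0 N : (0 <= ((n.+1)`!%:R * 'C(N, n)%:R *
                      (run_count k x N < r)%:R)%:E :> \bar R)%E.
  by rewrite lee_fin !mulr_ge0.
have [[m0 hm0]|none] := pselect (exists m, (r <= run_count k x m)%N).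
  have [m hm minm] :=
    ex_minnP (ex_intro (fun m => r <= run_count k x m)%N _ hm0).
  rewrite (waiting_time_fin _ hm minm).
  under eq_bigr do rewrite -EFinB.
  rewrite prodEFin prod_subr_ffact (nneseries_split _ m) // add0n.
  rewrite [X in (_ + X)%E]eseries0 ?adde0; last first.
    move=> i mi _.
    by rewrite ltnNge (leq_trans hm (run_count_homo _ _ mi)) mulr0.
  rewrite sumEFin; congr _%:E.
  rewrite -bin_ffact -hockey_stick mulnC natrM natr_sum mulr_sumr !big_nat.
  apply: eq_bigr => i /andP[_ im].
  rewrite (_ : (_ < r)%N) ?mulr1 // ltnNge.
  by apply: contraL im => /minm; rewrite -leqNgt.
have {}none m : (run_count k x m < r)%N.
  by rewrite ltnNge; apply/negP => rm; apply: none; exists m.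
rewrite waiting_time_pinfty // big_ord_recl /= addye //.
rewrite gt0_mulye; last first.
  by apply: (big_ind (fun y => 0 < y)%E) => // [a b|i _];
    [exact: mule_gt0 | rewrite addye].
(* The sum of the terms below M + n is at least 'C(M + n, n.+1) >= M >= A. *)
apply/esym/eqyP => A A0.
pose M := `|Num.ceil A|%N.
apply: (@le_trans _ _ (\sum_(0 <= N < M + n) ((n.+1)`!%:R * 'C(N, n)%:R *
                      (run_count k x N < r)%:R)%:E)%E); last first.
  exact: nneseries_lim_ge.
rewrite sumEFin lee_fin.
under eq_bigr do rewrite none mulr1.
rewrite -mulr_sumr -natr_sum hockey_stick.
have binM : (M <= 'C(M + n, n.+1))%N.
  elim: (M) => // m IH; rewrite addSn binS.
  by rewrite -[m.+1]addn1 leq_add // bin_gt0 leq_addl.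
apply: (@le_trans _ _ M%:R).
  rewrite /M natr_absz ger0_norm ?ceil_ge0 ?(lt_trans _ A0) //; exact: ceil_ge.
by rewrite -natrM ler_nat (leq_trans binM) // leq_pmull // fact_gt0.
Qed.

Section FactorialMoment.
Context (R : realType) (d : measure_display) (T : measurableType d).
Variables (P : probability T R) (X : nat -> {RV P >-> bool}).
Hypothesis hindep : mutually_independent P (fun i => X i : T -> bool).
Variable k : nat.

Lemma expectation_ffact_waiting_time r n (L : R) :
  (fun M => \sum_(0 <= N < M) 'C(N, n)%:R * wait_tail X k r N) @ \oo --> L ->
  (\int[P]_w \prod_(m < n.+1) (waiting_time R k r (X ^~ w) - m%:R%:E))%E =
  ((n.+1)`!%:R * L)%:E.
Proof.
move=> cvL; pose A N := event X (fun x => run_count k x N < r)%N.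
have dA N := @determined_count k N N (fun n => n < r)%N (leqnn N).
have mA N : measurable (A N) := measurable_event hindep (dA N).
pose a N : R := (n.+1)`!%:R * 'C(N, n)%:R.
have a0 N : 0 <= a N by rewrite mulr_ge0.
have -> : (\int[P]_w \prod_(m < n.+1) (waiting_time R k r (X ^~ w) - m%:R%:E) =
           \int[P]_w \sum_(0 <= N <oo) (a N * \1_(A N) w)%:E)%E.
  apply: eq_integral => w _; rewrite ffact_waiting_time.
  by apply: eq_eseriesr => N _; rewrite indicE mem_setE.
rewrite integral_nneseries //; last 2 first.
- move=> N; exact/measurable_EFinP/measurable_funM.
- by move=> N w _; rewrite lee_fin mulr_ge0.
have intA N :
    (\int[P]_w (a N * \1_(A N) w)%:E = (a N * wait_tail X k r N)%:E)%E.
  rewrite (integralZl_indic _ (fun=> A N)) ?integral_indic ?setIT //.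
    by rewrite (EFinM (a N)); congr (_ * _)%E; exact: (probE hindep (dA N)).
  by rewrite ltNge a0.
rewrite (eq_eseriesr (fun N _ => intA N)).
apply: cvg_lim => //.
have -> : (fun M => \sum_(0 <= N < M) (a N * wait_tail X k r N)%:E)%E =
   EFin \o (fun M =>
     (n.+1)`!%:R * \sum_(0 <= N < M) 'C(N, n)%:R * wait_tail X k r N).
  apply/funext => M; rewrite /= sumEFin mulr_sumr; congr _%:E.
  by apply: eq_bigr => N _; rewrite mulrA.
by apply: cvg_EFin; [exact: nearW | exact: cvgMr].
Qed.

End FactorialMoment.

Theorem mainTheorem10 (R : realType) (d : measure_display)
    (T : measurableType d) (P : probability T R)
    (k r : nat) (hk : (1 <= k)%N) (hr : (1 <= r)%N)
    (p q : R) (hp0 : 0 < p) (hp1 : p < 1) (hq : q = 1 - p)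
    (X : nat -> {RV P >-> bool})
    (hindep : mutually_independent P (fun i => X i : T -> bool))
    (hX : forall i : nat, P [set w | X i w = true] = p%:E)
    (Y : T -> \bar R)
    (hY : forall w, Y w = waiting_time R k r (fun i => X i w))
    (n : nat) (hn : (1 <= n)%N) :
  exists S : R,
    [sequence
      \sum_(maxn 0 (n - r * k) <= v < N)
        'C(v + r * k, n)%:R *
        \sum_(0 <= j < v.+1)
          (-1) ^+ (v - j) * p ^+ (v - j) * 'C(r, v - j)%:R *
          \sum_(0 <= i < (j %/ k.+1).+1)
            (-1) ^+ i * q ^+ i * p ^+ (i * k) *
            'C(r + i - 1, r - 1)%:R * 'C(r + j - i * k - 1, r + i - 1)%:R]_N
      @ \oo --> S /\
    (\int[P]_w \prod_(m < n) (Y w - m%:R%:E))%E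
      = (n`!%:R * p ^+ (r * k) * S)%:E.
Proof.
case: n hn => [//|n _].
have rk_gt0 : (0 < r * k)%N by rewrite muln_gt0 hr hk.
have prk_gt0 : 0 < p ^+ (r * k) by rewrite exprn_gt0.
have prk_le1 : p ^+ (r * k) <= 1 by rewrite exprn_ile1 ?ltW.
have [||||L [cvL cvF]] := @cvg_sum_bin_by_parts R (wait_tail X k r) (r * k)
    (1 - p ^+ (r * k)) n.
- by rewrite subr_ge0.
- by rewrite ltrBlDr ltrDl.
- by move=> N; exact: prob_ge0.
- by move=> N; exact: wait_tail_geometric.
exists (L / p ^+ (r * k)); split; last first.
  under eq_integral do under eq_bigr do rewrite hY.
  rewrite (expectation_ffact_waiting_time hindep cvL).
  by congr _%:E; field; rewrite gt_eqF.
have termE v : \sum_(0 <= j < v.+1)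
    (-1) ^+ (v - j) * p ^+ (v - j) * 'C(r, v - j)%:R *
    \sum_(0 <= i < (j %/ k.+1).+1)
      (-1) ^+ i * q ^+ i * p ^+ (i * k) *
      'C(r + i - 1, r - 1)%:R * 'C(r + j - i * k - 1, r + i - 1)%:R =
  wait_pmf X k r (v + r * k)%N / p ^+ (r * k).
  rewrite (wait_pmfE hindep hX hk) !fctE iter_delayE leq_addl addnK.
  rewrite -[_ *: _]/(_ * _) mulrC mulKf ?gt_eqF // /nbcoef iter_dampE.
  apply: eq_bigr => j _; congr (_ * _).
  case: (r) hr => // r' _; apply: eq_bigr => i _.
  have -> : (r'.+1 + i - 1 = r' + i)%N by lia.
  have -> : (r'.+1 + j - i * k - 1 = r' + j - i * k)%N by lia.
  rewrite subn1 -hq [(- (q * _)) ^+ i]exprNn.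
  by rewrite exprMn -exprM [(k * i)%N]mulnC !mulrA.
have -> : [sequence
      \sum_(maxn 0 (n.+1 - r * k) <= v < N)
        'C(v + r * k, n.+1)%:R *
        \sum_(0 <= j < v.+1)
          (-1) ^+ (v - j) * p ^+ (v - j) * 'C(r, v - j)%:R *
          \sum_(0 <= i < (j %/ k.+1).+1)
            (-1) ^+ i * q ^+ i * p ^+ (i * k) *
            'C(r + i - 1, r - 1)%:R * 'C(r + j - i * k - 1, r + i - 1)%:R]_N =
  (fun N => (\sum_(0 <= v < N + (r * k).-1)
     'C(v.+1, n.+1)%:R * (wait_tail X k r v - wait_tail X k r v.+1))
     / p ^+ (r * k)).
  apply/funext => N; rewrite /= max0n.
  under eq_bigr do rewrite termE mulrA.
  rewrite -mulr_suml; congr (_ / _).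
  have wait0 M : (M < r * k)%N -> wait_pmf X k r M = 0.
    move=> Mrk; rewrite (wait_pmfE hindep hX hk) !fctE iter_delayE.
    by rewrite leqNgt Mrk scaler0.
  (* Both sides equal the sum of 'C(M, n.+1) * wait_pmf M over M < N + r * k:
     the waiting time is at least r * k, and 'C(M, n.+1) vanishes for M <= n. *)
  transitivity (\sum_(0 <= M < N + r * k) 'C(M, n.+1)%:R * wait_pmf X k r M).
    rewrite [RHS](@big_cat_nat _ _ _ (r * k)) ?leq_addl //=.
    rewrite [X in _ = X + _]big_nat [X in _ = X + _]big1 ?add0r; last first.
      by move=> M /andP[_ /wait0->]; rewrite mulr0.
    rewrite -[X in \sum_(X <= _ < N + _) _]add0n big_addn addnK.
    have [Nle|Nlt] := leqP (n.+1 - r * k) N; last first.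
      rewrite big_geq ?(ltnW Nlt) // big_nat big1 // => v /andP[_ vN].
      by rewrite bin_small ?mul0r //; lia.
    rewrite [RHS](@big_cat_nat _ _ _ (n.+1 - r * k)) //=.
    rewrite [X in _ = X + _]big_nat.
    rewrite [X in _ = X + _]big1 ?add0r // => v /andP[_ vn].
    by rewrite bin_small ?mul0r //; lia.
  rewrite -[X in \sum_(0 <= M < _ + X) _](prednK rk_gt0) addnS big_nat_recl //.
  rewrite bin0n mul0r add0r; apply: eq_bigr => v _; congr (_ * _).
  by rewrite /wait_pmf !fctE /= sub0r opprB.
apply: cvgMl.
by rewrite (cvg_shiftn (r * k).-1 (fun M => \sum_(0 <= v < M)
     'C(v.+1, n.+1)%:R * (wait_tail X k r v - wait_tail X k r v.+1))).
Qed.
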